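(* Let $n\ge 2$ and $\max\{-1,2-n\}<a<1$. Suppose $u\in C^2(\mathbb{R}^n_+)\cap C^1(\overline{\mathbb{R}^n_+})$ satisfies $\operatorname{div}(x_n^a\nabla u)=0$ and $u>0$ in $\mathbb{R}^n_+$, together with the boundary condition $x_n^a\frac{\partial u}{\partial x_n}=0$ on $\partial\mathbb{R}^n_+$, in the sense that $\lim_{x_n\to 0^+}x_n^a\frac{\partial u}{\partial x_n}=0$, i.e. $x_n^a\frac{\partial u}{\partial x_n}(x)\to 0$ as $x\in\mathbb{R}^n_+$ tends to any point of $\partial\mathbb{R}^n_+$. Then $u=C$ for some positive constant $C$.
   Context: $\mathbb{R}^n_+=\{x=(x',x_n)\in\mathbb{R}^n: x_n>0\}$ is the open upper half space, $\overline{\mathbb{R}^n_+}=\{x_n\ge 0\}$ and $\partial\mathbb{R}^n_+=\{x_n=0\}$. *)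

(* Defs.v *)
From mathcomp Require Import all_boot all_order all_algebra.
From mathcomp Require Import all_classical all_reals all_analysis.

Set Implicit Arguments.
Unset Strict Implicit.
Unset Printing Implicit Defensive.

Import Order.TTheory GRing.Theory Num.Theory.
Import numFieldNormedType.Exports.

Local Open Scope classical_set_scope.
Local Open Scope ring_scope.

(* The ambient space is 'rV[R]_n.+1, so that the last coordinate x_n of the
   usual notation is [x 0 ord_max] and the dimension is n.+1.  The topology
   and the derivatives come from the sup norm, which is equivalent to the
   Euclidean one. *)

Definition half_space (R : realType) (n : nat) : set 'rV[R]_n.+1 :=
  [set x | 0 < x 0 ord_max].

Definition closed_half_space (R : realType) (n : nat) : set 'rV[R]_n.+1 :=
  [set x | 0 <= x 0 ord_max].

Definition half_space_boundary (R : realType) (n : nat) : set 'rV[R]_n.+1 :=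
  [set x | x 0 ord_max = 0].

Arguments half_space R n : clear implicits.
Arguments closed_half_space R n : clear implicits.
Arguments half_space_boundary R n : clear implicits.

Definition partial (R : realType) (n : nat) (i : 'I_n.+1)
    (f : 'rV[R]_n.+1 -> R) (x : 'rV[R]_n.+1) : R :=
  'D_(delta_mx 0 i : 'rV[R]_n.+1) f x.

Definition grad (R : realType) (n : nat) (f : 'rV[R]_n.+1 -> R)
    (x : 'rV[R]_n.+1) : 'rV[R]_n.+1 :=
  \row_(i < n.+1) partial i f x.

Definition div (R : realType) (n : nat) (F : 'rV[R]_n.+1 -> 'rV[R]_n.+1)
    (x : 'rV[R]_n.+1) : R :=
  \sum_(i < n.+1) partial i (fun y => F y 0 i) x.

(* C^k(U) for an open set U: all partial derivatives of order at most k exist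
   and are continuous on U.  As [partial] is total, existence has to be
   required separately. *)
Fixpoint Ck (R : realType) (n k : nat) (U : set 'rV[R]_n.+1)
    (f : 'rV[R]_n.+1 -> R) : Prop :=
  (forall x, U x -> {for x, continuous f}) /\
  (if k is k'.+1 then
     forall i : 'I_n.+1,
       (forall x, U x -> derivable f x (delta_mx 0 i : 'rV[R]_n.+1)) /\
       Ck k' U (partial i f)
   else True).

(* C^1(closure U) for an open set U: f is C^1 on U, and f and its first order
   partial derivatives on U extend continuously to closure U.  The extension
   of f is f itself. *)
Definition C1_closure (R : realType) (n : nat) (U : set 'rV[R]_n.+1)
    (f : 'rV[R]_n.+1 -> R) : Prop :=
  [/\ Ck 1 U f,
      {within closure U, continuous f} &
      forall i : 'I_n.+1, exists g : 'rV[R]_n.+1 -> R,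
        {within closure U, continuous g} /\
        (forall x, U x -> g x = partial i f x)].

Lemma closure_half_space (R : realType) (n : nat) :
  closure (half_space R n) = closed_half_space R n.
Proof.
apply/seteqP; split.
  have cl : closed (closed_half_space R n).
    have -> : closed_half_space R n =
        (fun x : 'rV[R]_n.+1 => x 0 ord_max) @^-1` [set y | 0 <= y] by [].
    apply: preimage_closed; last exact: closed_ge.
    by move=> x _; exact: coord_continuous.
  rewrite closureE => x; apply; split=> // y; exact: ltW.
move=> x x0 B /nbhs_ballP[e /= e0 xeB].
exists (x + const_mx (e / 2)); split.
  by rewrite /half_space /= !mxE ltr_wpDl// divr_gt0.
apply: xeB; split=> // i j; rewrite /ball/= !mxE opprD addNKr normrN.
by rewrite gtr0_norm ?divr_gt0// gtr_pMr// invf_lt1// ltr1n.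
Qed.

(* Main.v *)
Require Import Defs.
From mathcomp Require Import all_boot all_order all_algebra.
From mathcomp Require Import all_classical all_reals all_analysis.
From mathcomp Require Import ring lra.

Set Implicit Arguments.
Unset Strict Implicit.
Unset Printing Implicit Defensive.

Import Order.TTheory GRing.Theory Num.Theory.
Import numFieldNormedType.Exports.

Local Open Scope classical_set_scope.
Local Open Scope ring_scope.

(** The operator L u = sum_i u_ii + (a / x_n) u_n, which is the divergence form
    operator divided by [x_n ^ a], is covariant under inversions centred on
    the flat boundary. Put N for the dimension and k = (N + a - 2) / 2; the
    hypothesis a > 2 - N says that k > 0. If [phi] is the inversion of squared
    radius s about a boundary point o and rho the squared distance to o, then
    the Kelvin transform v = rho ^ (- k) (u \o phi) again satisfies L v = 0
    ([kelvin_equation]) and, since a > -1, has zero conormal derivative on the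
    boundary away from o ([cvg_kelvin_conormal]).

    Outside the ball rho < s compare u with s ^ k v. The two agree on the sphere
    rho = s, u is nonnegative and v decays like rho ^ (- k), so a minimum
    principle with the Neumann condition on the flat part of the boundary
    ([minimum_principle]), applied on the shells s <= rho <= M after subtracting
    a small multiple of a barrier, gives s ^ k v <= u for every centre o and
    every s ([kelvin_comparison]).

    Two points y, z with z_n < y_n are exchanged by the inversion centred where
    the line through them meets the boundary, and the comparison reads
    (z_n / y_n) ^ k u(z) <= u(y) ([comparison_of_heights]). Letting z_n tend to
    y_n and using symmetry, u depends on x_n only. The equation then says that
    x_n ^ a u_n is constant, the boundary condition that it vanishes, so u is
    constant. *)

(** * Derivatives along lines and the chain rule *)

Lemma is_deriveP {R : realType} {V W : normedModType R} (f : V -> W) (x v : V)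
    (l : W) :
  is_derive x v f l <->
  h^-1 *: (f (h *: v + x) - f x) @[h --> (0 : R)^'] --> l.
Proof.
split=> [[df <-]|fl]; first exact: df.
by split; [apply/cvg_ex; exists l|exact/cvg_lim].
Qed.

Lemma is_derive_line {R : realType} {V W : normedModType R} (f : V -> W)
    (x v : V) (t : R) (l : W) :
  is_derive (x + t *: v) v f l <-> is_derive t 1 (fun s => f (x + s *: v)) l.
Proof.
rewrite !is_deriveP.
suff -> : (fun h : R => h^-1 *: (f (h *: v + (x + t *: v)) - f (x + t *: v)))
    = (fun h : R => h^-1 *: (f (x + (h *: 1 + t) *: v) - f (x + t *: v))) by [].
by apply/funext => h; rewrite scalerDl [_%:A]mulr1 addrCA.
Qed.

Lemma is_derive_line0 {R : realType} {V W : normedModType R} (f : V -> W)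
    (x v : V) (l : W) :
  is_derive x v f l <-> is_derive (0 : R) 1 (fun s => f (x + s *: v)) l.
Proof. by rewrite -is_derive_line scale0r addr0. Qed.

Lemma is_derive_outer {R : realType} {V : normedModType R} (f : R -> R)
    (g : V -> R) (x v : V) (a b : R) :
  is_derive (g x) 1 f a -> is_derive x v g b ->
  is_derive x v (fun y => f (g y)) (a * b).
Proof.
move=> fa /is_derive_line0 gb; apply/is_derive_line0.
have fa' : is_derive ((fun s : R => g (x + s *: v)) 0) 1 f a.
  by rewrite /= scale0r addr0.
exact: (@is_derive1_comp _ f (fun s => g (x + s *: v)) 0 a b fa' gb).
Qed.

Lemma mean_value_closed {R : realType} (f df : R -> R) (a b : R) : a < b ->
  (forall x, a <= x <= b -> is_derive x 1 f (df x)) ->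
  exists2 c, a < c < b & f b - f a = df c * (b - a).
Proof.
move=> ab fdf; have [||c cab E] := @MVT R f df a b ab; last by exists c.
- by move=> x; rewrite in_itv/= => /andP[/ltW ax /ltW xb]; apply/fdf/andP.
- apply: derivable_within_continuous => x; rewrite in_itv/= => xab.
  by have [] := fdf x xab.
Qed.

Section ChainRule.
Context {R : realType} {n : nat}.
Implicit Types (x y q : 'rV[R]_n.+1) (i j : 'I_n.+1).

Notation e_ i := (delta_mx 0 i : 'rV[R]_n.+1).

Lemma rV_norm_le x (c : R) : 0 <= c ->
  (forall j, `|x 0 j| <= c) <-> `|x| <= c.
Proof.
move=> c0; split=> [xc|xc j].
  rewrite /Num.Def.normr/= mx_normrE (bigmax_le _ c0)//= => -[i j] _ /=.
  by rewrite ord1.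
apply: le_trans xc; rewrite /Num.Def.normr/= mx_normrE.
exact: (le_bigmax _ (fun ij => `|x ij.1 ij.2|) (0, j)).
Qed.

Lemma rV_subE x y j : (x - y) 0 j = x 0 j - y 0 j.
Proof. by rewrite !mxE. Qed.

Lemma rV_line_coord x i j (t : R) : (x + t *: e_ i) 0 j = x 0 j + t * (j == i)%:R.
Proof. by rewrite !mxE eqxx. Qed.

(** The segment from q to y is replaced by a staircase with edges parallel to
    the axes, and the mean value theorem is used on each edge; the sup norm
    keeps the whole staircase within distance |y - q| of q. *)
Lemma mean_value_coord (g : 'rV[R]_n.+1 -> R) (dg : 'I_n.+1 -> 'rV[R]_n.+1 -> R)
    q (r : R) :
  (forall y, `|y - q| < r -> forall i, is_derive y (e_ i) g (dg i y)) ->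
  forall y, `|y - q| < r -> exists xi : 'I_n.+1 -> 'rV[R]_n.+1,
    (forall i, `|xi i - q| <= `|y - q|) /\
    g y - g q = \sum_i (y 0 i - q 0 i) * dg i (xi i).
Proof.
move=> gd y yr.
pose z (m : nat) : 'rV[R]_n.+1 :=
  \row_j (if (j < m)%N then y 0 j else q 0 j).
have zS i : z i.+1 = z i + (y 0 i - q 0 i) *: e_ i.
  apply/rowP => j; rewrite rV_line_coord !mxE ltnS leq_eqVlt.
  have [->|ji] := eqVneq j i; first by rewrite eqxx ltnn mulr1 addrC subrK.
  by rewrite val_eqE (negbTE ji) mulr0 addr0.
have edge i : exists x, `|x - q| <= `|y - q| /\
    g (z i.+1) - g (z i) = (y 0 i - q 0 i) * dg i x.
  set c := y 0 i - q 0 i.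
  pose p (t : R) : 'rV[R]_n.+1 := z i + (c * t) *: e_ i.
  have pq (t : R) : 0 <= t <= 1 -> `|p t - q| <= `|y - q|.
    move=> /andP[t0 t1]; apply/rV_norm_le => // j.
    have /rV_norm_le : `|y - q| <= `|y - q| by [].
    move=> /(_ (normr_ge0 _))/(_ j); rewrite rV_subE => yq.
    apply: le_trans yq.
    rewrite rV_subE rV_line_coord /c !mxE.
    have [->|ji] := eqVneq j i.
      rewrite ltnn mulr1 addrAC subrr add0r normrM (ger0_norm t0).
      by rewrite ler_piMr.
    rewrite mulr0 addr0; case: ifP => //.
    by rewrite subrr normr0 normr_ge0.
  have dp (t : R) : 0 <= t <= 1 ->
      is_derive t 1 (fun s => g (p s)) (dg i (p t) * c).
    move=> t01.
    have ds : is_derive t (1 : R) (fun s : R => c * s) c.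
      have := is_deriveZ c (is_derive_id t (1 : R)).
      by rewrite [_%:A]mulr1.
    have /is_derive_line dl := gd _ (le_lt_trans (pq _ t01) yr) i.
    exact: (@is_derive1_comp _ _ (fun s : R => c * s) t _ _ dl ds).
  have [t t01 E] := mean_value_closed ltr01 dp.
  move: E; rewrite subr0 mulr1 /p mulr0 scale0r addr0 mulr1 -zS => E; exists (p t).
  split; last by rewrite E mulrC.
  by apply: pq; move: t01 => /andP[/ltW -> /ltW ->].
have /choice[xi xiP] := edge.
exists xi; split; first by move=> i; exact: (xiP i).1.
have yE : z n.+1 = y by apply/rowP => j; rewrite mxE ltn_ord.
have qE : z 0%N = q by apply/rowP => j; rewrite mxE.
rewrite -[in g y]yE -[in g q]qE.
have -> : g (z n.+1) - g (z 0%N) = \sum_(0 <= k < n.+1) (g (z k.+1) - g (z k)).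
  by rewrite (telescope_sumr (g \o z)).
rewrite big_mkord; apply: eq_bigr => i _.
by rewrite (xiP i).2.
Qed.

(** Carathéodory form of differentiability: the increment of g is the sum of
    the coordinate increments, weighted by functions that are continuous at
    the base point. *)
Lemma is_derive_chain (g : 'rV[R]_n.+1 -> R)
    (dg : 'I_n.+1 -> 'rV[R]_n.+1 -> R)
    (c : R -> 'rV[R]_n.+1) (t : R) (dc : 'I_n.+1 -> R) :
  (\forall y \near c t, forall i, is_derive y (e_ i) g (dg i y)) ->
  (forall i, {for c t, continuous (dg i)}) ->
  (forall j, is_derive t 1 (fun s => c s 0 j) (dc j)) ->
  is_derive t 1 (fun s => g (c s)) (\sum_j dc j * dg j (c t)).
Proof.
move=> /nbhs_ballP[r /= r0 gd] dgc cd.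
have gd' y : `|y - c t| < r -> forall i, is_derive y (e_ i) g (dg i y).
  by move=> yr; apply: gd; rewrite -ball_normE /= distrC.
have mv (y : 'rV[R]_n.+1) : exists xi : 'I_n.+1 -> 'rV[R]_n.+1,
    (forall i, `|xi i - c t| <= `|y - c t|) /\
    (`|y - c t| < r ->
     g y - g (c t) = \sum_i (y 0 i - c t 0 i) * dg i (xi i)).
  have [yr|yr] := pselect (`|y - c t| < r).
    by have [xi [? ?]] := mean_value_coord gd' yr; exists xi.
  by exists (fun=> y); split.
have /choice[xi xiP] := mv.
have ct : {for t, continuous c}.
  apply/differentiable_continuous/derivable1_diffP/derivable_mxP => i j.
  by rewrite ord1; have [] := cd j.
have cl : (c (h *: 1 + t) @[h --> (0 : R)^'] --> c t).
  have ht : (h *: 1 + t) @[h --> (0 : R)^'] --> t.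
    rewrite -[X in _ --> X]add0r; apply: cvgD; last exact: cvg_cst.
    have -> : (fun h : R => h *: (1 : R)) = id by apply/funext => h; exact: mulr1.
    exact: cvg_within.
  exact: (cvg_comp _ _ ht ct).
apply/is_deriveP.
have key : \sum_j (h^-1 *: (c (h *: 1 + t) 0 j - c t 0 j)
      * dg j (xi (c (h *: 1 + t)) j)) @[h --> (0 : R)^']
    --> \sum_j dc j * dg j (c t).
  apply: cvg_big => [|j _]; first exact: add_continuous.
  apply: cvgM; first by have /is_deriveP := cd j.
  apply: (cvg_comp (fun h => xi (c (h *: 1 + t)) j) (dg j) _ (dgc j)).
  apply/cvgrPdist_lt => e e0.
  move/cvgrPdist_lt: cl => /(_ e e0); apply: filterS => h.
  rewrite /= distrC => ch; rewrite distrC.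
  exact: le_lt_trans ((xiP _).1 j) ch.
apply: cvg_trans key; apply: near_eq_cvg.
move/cvgrPdist_lt: cl => /(_ r r0); apply: filterS => h /=.
rewrite distrC => /((xiP _).2) ->.
rewrite scaler_sumr; apply: eq_bigr => j _.
by rewrite -scalerAl.
Qed.

End ChainRule.

(** * A minimum principle on the half space *)

Lemma second_derivative_at_min {R : realType} (f df : R -> R) (r l : R) : 0 < r ->
  (forall t : R, `|t| < r -> is_derive t 1 f (df t)) ->
  is_derive (0 : R) 1 df l ->
  (forall t, `|t| < r -> f 0 <= f t) -> df 0 = 0 /\ 0 <= l.
Proof.
move=> r0 fdf dfl fmin.
have inr (t : R) : t \in `]- r, r[%R -> `|t| < r by rewrite in_itv/= ltr_norml.
have df0 : df 0 = 0.
  have [_ f0] : is_derive (0 : R) 1 f 0.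
    apply: (@derive1_at_min R f (- r) r 0); first by lra.
    - by move=> t /inr /fdf[].
    - by rewrite in_itv/= r0 oppr_lt0 r0.
    - by move=> t /inr; exact: fmin.
  have [|_ <-] := fdf 0; first by rewrite normr0.
  exact: f0.
split=> //; rewrite leNgt; apply/negP => l0.
have /is_deriveP := dfl; rewrite df0 => /cvgr_lt /(_ 0 l0).
move=> /nbhs_ballP[d /= d0 dneg].
pose h := Num.min d r / 2.
have dr0 : 0 < Num.min d r by rewrite lt_min d0.
have h0 : 0 < h by rewrite divr_gt0.
have hdr : h < Num.min d r by rewrite ltr_pdivrMr// ltr_pMr// ltr1n.
have /andP[hd hr] : (h < d) && (h < r) by rewrite -lt_min.
have [|c /andP[c0 ch] E] := @mean_value_closed R f df 0 h h0.
  move=> x /andP[x0 xh]; apply: fdf; rewrite ger0_norm//.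
  exact: le_lt_trans hr.
have dfc : df c < 0.
  have := dneg c; rewrite /ball/= sub0r normrN gtr0_norm//.
  move=> /(_ (lt_trans ch hd)); rewrite gt_eqF// => /(_ isT).
  rewrite [c *: 1]mulr1 addr0 subr0 => cdf.
  by rewrite -(pmulr_rlt0 _ (_ : 0 < c^-1)) ?invr_gt0.
have : f 0 <= f h by apply: fmin; rewrite gtr0_norm.
rewrite -subr_ge0 E subr0 leNgt => /negP; apply.
by rewrite nmulr_rlt0.
Qed.

Section MinimumPrinciple.
Context {R : realType} {n : nat}.
Implicit Types (x y p : 'rV[R]_n.+1) (i : 'I_n.+1).

Notation e_ i := (delta_mx 0 i : 'rV[R]_n.+1).

Lemma open_half_space : open (half_space R n).
Proof.
have -> : half_space R n = (fun x : 'rV[R]_n.+1 => x 0 ord_max) @^-1` [set t | t > 0] by [].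
apply: open_comp; last exact: open_gt.
by move=> x _; exact: coord_continuous.
Qed.

Lemma closed_closed_half_space : closed (closed_half_space R n).
Proof. by rewrite -closure_half_space; exact: closed_closure. Qed.

Lemma norm_delta i : `|e_ i| <= 1.
Proof.
apply/rV_norm_le => // j; rewrite mxE eqxx/=.
by case: (j == i); rewrite ?normr1 ?normr0.
Qed.

Lemma nbhs_line p i (P : set 'rV[R]_n.+1) : nbhs p P ->
  exists2 r : R, 0 < r & forall t : R, `|t| < r -> P (p + t *: e_ i).
Proof.
move=> /nbhs_ballP[r /= r0 rP]; exists r => // t tr; apply: rP.
rewrite -ball_normE /= opprD addNKr normrN normrZ.
by apply: le_lt_trans tr; rewrite ler_piMr// norm_delta.
Qed.

(** At an interior minimum of w all first derivatives vanish and all second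
    ones are nonnegative, which contradicts the strict differential
    inequality; at a minimum on the flat boundary w would have to decrease
    strictly along the inner normal. *)
Lemma minimum_principle (a m : R) (A U : set 'rV[R]_n.+1)
    (w : 'rV[R]_n.+1 -> R) (dw ddw : 'I_n.+1 -> 'rV[R]_n.+1 -> R) :
  compact A -> open U -> U `<=` A ->
  {within A `&` closed_half_space R n, continuous w} ->
  (forall p i, half_space R n p -> U p -> is_derive p (e_ i) w (dw i p)) ->
  (forall p i, half_space R n p -> U p ->
     is_derive p (e_ i) (dw i) (ddw i p)) ->
  (forall p, half_space R n p -> U p ->
     \sum_i ddw i p + a / p 0 ord_max * dw ord_max p < 0) ->
  (forall p, half_space_boundary R n p -> U p ->
     \forall y \near within (half_space R n) (nbhs p), dw ord_max y < 0) ->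
  (forall p, closed_half_space R n p -> A p -> ~ U p -> m <= w p) ->
  forall p, closed_half_space R n p -> A p -> m <= w p.
Proof.
move=> Ac Uo UA wc wd dwd Lw bdw mw p pH pA.
set K := A `&` closed_half_space R n.
have Kc : compact K.
  apply: (subclosed_compact _ Ac); last by move=> y [].
  apply: closedI; last exact: closed_closed_half_space.
  by apply: compact_closed => //; exact: norm_hausdorff.
have K0 : K !=set0 by exists p.
have [c /set_mem[cA cH] cmin] := EVT_min_rV K0 Kc wc.
have {}cmin y : K y -> w c <= w y by move=> /mem_set; exact: cmin.
apply: le_trans (cmin p _) => //.
have [cU|/mw] := pselect (U c); last exact.
exfalso.
have [c0|] := ltP 0 (c 0 ord_max).
  have HU : nbhs c (half_space R n `&` U).
    by apply: open_nbhs_nbhs; split=> //; apply: openI => //; exact: open_half_space.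
  have stat i : dw i c = 0 /\ 0 <= ddw i c.
    have [r r0 rHU] := nbhs_line i HU.
    have := @second_derivative_at_min R (fun t => w (c + t *: e_ i))
      (fun t => dw i (c + t *: e_ i)) r (ddw i c) r0.
    rewrite scale0r addr0; apply.
    + by move=> t /rHU[tH tU]; exact: (is_derive_line _ _ _ _ _).1 (wd _ _ tH tU).
    + exact: (is_derive_line0 _ _ _ _).1 (dwd _ _ c0 cU).
    + move=> t /rHU[tH tU]; apply: cmin; split; first exact: UA.
      exact: ltW.
  have := Lw c c0 cU; rewrite (stat _).1 mulr0 addr0 ltNge sumr_ge0// => i _.
  exact: (stat i).2.
rewrite le_eqVlt ltNge; have cH' : 0 <= c 0 ord_max := cH.
rewrite cH' orbF => /eqP c0.
have near_c : nbhs c [set y | half_space R n y -> dw ord_max y < 0 /\ U y].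
  have := bdw c c0 cU; have := open_nbhs_nbhs (conj Uo cU).
  by apply: filterS2 => y Uy dwy yH; split=> //; exact: dwy.
have [r r0 rc] := nbhs_line ord_max near_c.
pose f (t : R) := w (c + t *: e_ ord_max).
have lineH (t : R) : 0 < t -> half_space R n (c + t *: e_ ord_max).
  by move=> t0; rewrite /half_space/= rV_line_coord c0 eqxx mulr1 add0r.
have fdecr (s t : R) : 0 < s -> s < t -> t < r -> f t < f s.
  move=> s0 st tr.
  have inr (x : R) : s <= x <= t -> 0 < x /\ `|x| < r.
    move=> /andP[sx xt]; have x0 := lt_le_trans s0 sx.
    by split=> //; rewrite gtr0_norm//; exact: le_lt_trans tr.
  have [|x /andP[sx xt] E] :=
      @mean_value_closed R f (fun x : R => dw ord_max (c + x *: e_ ord_max)) s t st.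
    move=> x /inr[x0 xr]; have [_ xU] := rc x xr (lineH x x0).
    exact: (is_derive_line _ _ _ _ _).1 (wd _ _ (lineH x x0) xU).
  have [|x0 xr] := inr x; first by rewrite !ltW.
  by rewrite -subr_lt0 E nmulr_rlt0 ?subr_gt0//; have [] := rc x xr (lineH x x0).
have fK (t : R) : 0 < t -> t < r -> K (c + t *: e_ ord_max).
  move=> t0 tr; split; last exact/ltW/lineH.
  by apply: UA; have [|] := rc t _ (lineH t t0); rewrite ?gtr0_norm.
pose t := r / 2; have t0 : 0 < t by rewrite divr_gt0.
have tr : t < r by rewrite ltr_pdivrMr// ltr_pMr// ltr1n.
pose s := t / 2; have s0 : 0 < s by rewrite divr_gt0.
have st : s < t by rewrite ltr_pdivrMr// ltr_pMr// ltr1n.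
(* As c is a minimum, w c < f s; by continuity w stays below f s on the segment
   near c, where it ought to be larger because f decreases. *)
have cs : w c < f s.
  by apply: le_lt_trans (fdecr _ _ s0 st tr); apply/cmin/fK.
move/subspace_continuousP: wc => /(_ c (conj cA cH)) /cvgr_lt /(_ _ cs).
move=> /(nbhs_line ord_max)[r' r'0 r'c].
pose q := Num.min r' s / 2.
have rs0 : 0 < Num.min r' s by rewrite lt_min r'0.
have q0 : 0 < q by rewrite divr_gt0.
have : q < Num.min r' s by rewrite ltr_pdivrMr// ltr_pMr// ltr1n.
rewrite lt_min => /andP[qr' qs].
have sr := lt_trans st tr.
have := r'c q _ (fK q q0 (lt_trans qs sr)); rewrite gtr0_norm// => /(_ qr').
by rewrite ltNge ltW// fdecr.
Qed.

End MinimumPrinciple.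

(** * Inversions and the Kelvin transform *)

Lemma is_derive_addf {R : realType} {V : normedModType R} (f g : V -> R) x v a b :
  is_derive x v f a -> is_derive x v g b ->
  is_derive x v (fun y => f y + g y) (a + b).
Proof. by move=> fa gb; exact: is_deriveD. Qed.

Lemma is_derive_mulf {R : realType} {V : normedModType R} (f g : V -> R) x v a b :
  is_derive x v f a -> is_derive x v g b ->
  is_derive x v (fun y => f y * g y) (a * g x + f x * b).
Proof.
move=> fa gb; apply: (is_derive_eq (is_deriveM fa gb)).
by rewrite addrC [_ *: a]mulrC.
Qed.

Lemma is_derive_cstf {R : realType} {V : normedModType R} (c : R) (x v : V) :
  is_derive x v (fun=> c) 0.
Proof. exact: is_derive_cst. Qed.

Lemma is_derive_mulcf {R : realType} {V : normedModType R} (c : R) (f : V -> R)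
    x v a :
  is_derive x v f a -> is_derive x v (fun y => c * f y) (c * a).
Proof. by move=> fa; exact: is_deriveZ. Qed.

Lemma is_derive_sumf {R : realType} {V : normedModType R} (m : nat)
    (f : 'I_m -> V -> R) x v (a : 'I_m -> R) :
  (forall j, is_derive x v (f j) (a j)) ->
  is_derive x v (fun y => \sum_j f j y) (\sum_j a j).
Proof.
move=> fa; have := is_derive_sum fa.
by rewrite (_ : \sum_j f j = fun y => \sum_j f j y) // funeqE => y; rewrite fct_sumE.
Qed.

Lemma is_derive_powf {R : realType} {V : normedModType R} (k : R) (f : V -> R)
    x v a :
  0 < f x -> is_derive x v f a ->
  is_derive x v (fun y => f y `^ k) (k * f x `^ (k - 1) * a).
Proof.
move=> fx0 fa.
exact: (@is_derive_outer R V (fun t => t `^ k) f x v _ a (is_derive1_powR k fx0) fa).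
Qed.

Lemma is_derive_invf {R : realType} {V : normedModType R} (f : V -> R) x v a :
  0 < f x -> is_derive x v f a ->
  is_derive x v (fun y => (f y)^-1) (- a / f x ^+ 2).
Proof.
move=> /lt0r_neq0 fx0 [fd <-]; split; first exact: derivableV.
by rewrite deriveV// [_ *: _]mulrC mulNr mulrN.
Qed.

Lemma sum_delta {R : realType} (m : nat) (i : 'I_m) (f : 'I_m -> R) :
  \sum_j (j == i)%:R * f j = f i.
Proof.
rewrite (bigD1 i)//= eqxx mul1r big1 ?addr0// => j /negbTE ->.
by rewrite mul0r.
Qed.

Definition sqdist {R : realType} {n : nat} (o x : 'rV[R]_n.+1) : R :=
  \sum_j (x 0 j - o 0 j) ^+ 2.

(** The inversion in the sphere of radius [Num.sqrt s] about [o]. *)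
Definition inversion {R : realType} {n : nat} (o : 'rV[R]_n.+1) (s : R)
    (x : 'rV[R]_n.+1) : 'rV[R]_n.+1 :=
  o + (s / sqdist o x) *: (x - o).

Definition kelvin {R : realType} {n : nat} (k s : R) (o : 'rV[R]_n.+1)
    (u : 'rV[R]_n.+1 -> R) (x : 'rV[R]_n.+1) : R :=
  sqdist o x `^ (- k) * u (inversion o s x).

Section Inversion.
Context {R : realType} {n : nat}.
Implicit Types (x y o : 'rV[R]_n.+1) (i j : 'I_n.+1) (s : R).

Notation e_ i := (delta_mx 0 i : 'rV[R]_n.+1).

Lemma inversionE o s x j :
  inversion o s x 0 j = o 0 j + s / sqdist o x * (x 0 j - o 0 j).
Proof. by rewrite !mxE. Qed.

Lemma sqdist_ge0 o x : 0 <= sqdist o x.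
Proof. by apply: sumr_ge0 => j _; exact: sqr_ge0. Qed.

Lemma sqdist_gt0 o x j : x 0 j != o 0 j -> 0 < sqdist o x.
Proof.
move=> xj; rewrite /sqdist (bigD1 j)//= ltr_pwDl//.
  by rewrite exprn_even_gt0//= subr_eq0.
by apply: sumr_ge0 => i _; exact: sqr_ge0.
Qed.

Lemma half_space_sqdist_gt0 o x : half_space_boundary R n o ->
  half_space R n x -> 0 < sqdist o x.
Proof. by move=> oB xH; apply: (@sqdist_gt0 _ _ ord_max); rewrite oB gt_eqF. Qed.

Lemma inversion_ord_max o s x : half_space_boundary R n o ->
  inversion o s x 0 ord_max = s / sqdist o x * x 0 ord_max.
Proof. by move=> oB; rewrite inversionE oB add0r subr0. Qed.

Lemma inversion_half_space o s x : half_space_boundary R n o -> 0 < s ->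
  half_space R n x -> half_space R n (inversion o s x).
Proof.
move=> oB s0 xH; rewrite /half_space/= inversion_ord_max//.
by rewrite mulr_gt0// divr_gt0// half_space_sqdist_gt0.
Qed.

Lemma is_derive_coord o x i j :
  is_derive x (e_ i) (fun y => y 0 j - o 0 j) (j == i)%:R.
Proof.
apply/is_derive_line0.
have -> : (fun t : R => (x + t *: e_ i) 0 j - o 0 j) =
    (fun t : R => (x 0 j - o 0 j) + (j == i)%:R * t).
  by apply/funext => t; rewrite rV_line_coord mulrC addrAC.
have := is_derive_addf (is_derive_cstf (x 0 j - o 0 j) (0 : R) (1 : R))
  (is_derive_mulcf (j == i)%:R (is_derive_id (0 : R) (1 : R))).
by rewrite add0r mulr1.
Qed.

Lemma is_derive_sqdist o x i :
  is_derive x (e_ i) (sqdist o) (2 * (x 0 i - o 0 i)).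
Proof.
have := is_derive_sumf (fun j => is_derive_mulf
  (is_derive_coord o x i j) (is_derive_coord o x i j)).
rewrite (_ : (fun y => _) = sqdist o); last first.
  by apply/funext => y; apply: eq_bigr => j _; rewrite expr2.
move=> h; apply: (is_derive_eq h).
rewrite (eq_bigr (fun j => (j == i)%:R * (2 * (x 0 j - o 0 j)))) ?sum_delta//.
by move=> j _; ring.
Qed.

Lemma is_derive_sqdistV o x i : 0 < sqdist o x ->
  is_derive x (e_ i) (fun y => (sqdist o y)^-1)
    (- (2 * (x 0 i - o 0 i)) / sqdist o x ^+ 2).
Proof.
by move=> r0; exact: is_derive_invf r0 (is_derive_sqdist o x i).
Qed.

Lemma is_derive_inversion o s x i j : 0 < sqdist o x ->
  is_derive x (e_ i) (fun y => inversion o s y 0 j)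
    (s / sqdist o x * ((j == i)%:R
      - 2 * (x 0 i - o 0 i) / sqdist o x * (x 0 j - o 0 j))).
Proof.
move=> r0; have := is_derive_addf (is_derive_cstf (o 0 j) x (e_ i))
  (is_derive_mulcf s (is_derive_mulf (is_derive_sqdistV i r0)
     (is_derive_coord o x i j))).
rewrite (_ : (fun y => _) = (fun y => inversion o s y 0 j)); last first.
  by apply/funext => y; rewrite inversionE mulrA.
move=> h; apply: (is_derive_eq h); field.
by rewrite gt_eqF.
Qed.

(** The differential of an inversion is [s / sqdist o x] times the reflection
    in the hyperplane orthogonal to [x - o]. *)
Lemma is_derive_comp_inversion o s (g : 'rV[R]_n.+1 -> R)
    (dg : 'I_n.+1 -> 'rV[R]_n.+1 -> R) x i :
  half_space_boundary R n o -> 0 < s -> half_space R n x ->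
  (forall y j, half_space R n y -> is_derive y (e_ j) g (dg j y)) ->
  (forall y j, half_space R n y -> {for y, continuous (dg j)}) ->
  is_derive x (e_ i) (fun y => g (inversion o s y))
    (s / sqdist o x * (dg i (inversion o s x)
      - 2 * (x 0 i - o 0 i) / sqdist o x *
        \sum_j (x 0 j - o 0 j) * dg j (inversion o s x))).
Proof.
move=> oB s0 xH gd gc.
have r0 := half_space_sqdist_gt0 oB xH.
have ixH := inversion_half_space oB s0 xH.
apply/is_derive_line0.
have E : inversion o s x = inversion o s (x + (0 : R) *: e_ i).
  by rewrite scale0r addr0.
have := @is_derive_chain R n g dg (fun t : R => inversion o s (x + t *: e_ i)) 0
  (fun j => s / sqdist o x * ((j == i)%:R
      - 2 * (x 0 i - o 0 i) / sqdist o x * (x 0 j - o 0 j))).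
rewrite -E => /(_ _ _ _) h; apply: is_derive_eq.
  apply: h.
  - have : nbhs (inversion o s x) (half_space R n).
      by apply: open_nbhs_nbhs; split=> //; exact: open_half_space.
    by apply: filterS => y yH j; exact: gd.
  - by move=> j; exact: gc.
  - by move=> j; exact: (is_derive_line0 _ _ _ _).1 (is_derive_inversion s i j r0).
rewrite (eq_bigr (fun j => s / sqdist o x * ((j == i)%:R * dg j (inversion o s x)
  - 2 * (x 0 i - o 0 i) / sqdist o x * ((x 0 j - o 0 j) * dg j (inversion o s x))))).
  by rewrite -mulr_sumr sumrB sum_delta -mulr_sumr.
by move=> j _; ring.
Qed.

End Inversion.

Section KelvinTransform.
Context {R : realType} {n : nat} (k s : R) (o : 'rV[R]_n.+1)
  (u : 'rV[R]_n.+1 -> R) (du : 'I_n.+1 -> 'rV[R]_n.+1 -> R)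
  (ddu : 'I_n.+1 -> 'I_n.+1 -> 'rV[R]_n.+1 -> R).
Implicit Types (x : 'rV[R]_n.+1) (i j : 'I_n.+1).

Notation e_ i := (delta_mx 0 i : 'rV[R]_n.+1).
Notation rho := (sqdist o).
Notation phi := (inversion o s).
Notation d j x := (x 0 j - o 0 j).

Context (oB : half_space_boundary R n o) (s0 : 0 < s)
  (ud : forall x i, half_space R n x -> is_derive x (e_ i) u (du i x))
  (duc : forall x i, half_space R n x -> {for x, continuous (du i)})
  (dud : forall x i j, half_space R n x ->
     is_derive x (e_ i) (du j) (ddu i j x))
  (dduc : forall x i j, half_space R n x -> {for x, continuous (ddu i j)}).

(** The first derivative of [u] and the second derivative of [u] at [phi x] in
    the direction [x - o]; both are left unnormalized. *)
Definition radial1 x : R := \sum_j d j x * du j (phi x).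

Definition radial2 x : R :=
  \sum_j d j x * \sum_l d l x * ddu l j (phi x).

(** Differentiating the weight and the reflection part of the inversion both
    produce multiples of [x - o]; this is their common factor, so that the
    gradient of the Kelvin transform is a power of [rho] times
    [s * grad u (phi x) - kelvin_radial x * (x - o)]. *)
Definition kelvin_radial x : R :=
  2 * k * u (phi x) + 2 * s * ((rho x)^-1 * radial1 x).

Definition kelvin_grad i x : R :=
  rho x `^ (- k - 1) * (s * du i (phi x) - d i x * kelvin_radial x).

(** The remaining definitions are the derivatives of the previous ones, in the
    form in which the differentiation rules deliver them. *)
Definition radial1_grad i x : R :=
  du i (phi x) + s / rho x * ((\sum_j d j x * ddu i j (phi x))
    - 2 * d i x / rho x * radial2 x).

Definition kelvin_radial_grad i x : R :=
  2 * k * (s / rho x * (du i (phi x) - 2 * d i x / rho x * radial1 x))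
  + 2 * s * (- (2 * d i x) / rho x ^+ 2 * radial1 x
             + (rho x)^-1 * radial1_grad i x).

Definition kelvin_hess i x : R :=
  (- k - 1) * rho x `^ (- k - 1 - 1) * (2 * d i x)
    * (s * du i (phi x) - d i x * kelvin_radial x)
  + rho x `^ (- k - 1) *
    (s * (s / rho x * (ddu i i (phi x)
       - 2 * d i x / rho x * \sum_l d l x * ddu l i (phi x)))
     + -1 * (1 * kelvin_radial x + d i x * kelvin_radial_grad i x)).

Lemma is_derive_kelvin x i : half_space R n x ->
  is_derive x (e_ i) (kelvin k s o u) (kelvin_grad i x).
Proof.
move=> xH; have r0 := half_space_sqdist_gt0 oB xH.
have := is_derive_mulf (is_derive_powf (- k) r0 (is_derive_sqdist o x i))
  (is_derive_comp_inversion i oB s0 xH ud duc).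
move=> h; apply: (is_derive_eq h); rewrite /kelvin_grad /kelvin_radial -/(radial1 x).
have -> : rho x `^ (- k) = rho x `^ (- k - 1) * rho x.
  rewrite -[X in _ * X]powRr1 ?ltW// -powRD; first by rewrite subrK.
  by apply/implyP => _; rewrite gt_eqF.
by field; rewrite gt_eqF.
Qed.

(** Each [du j] is itself C1, so its composition with the inversion obeys the
    same chain rule as [u]. *)
Lemma is_derive_radial1 x i : half_space R n x ->
  is_derive x (e_ i) radial1 (radial1_grad i x).
Proof.
move=> xH.
have := is_derive_sumf (fun j => is_derive_mulf (is_derive_coord o x i j)
  (is_derive_comp_inversion i oB s0 xH
    (fun y l yH => @dud y l j yH) (fun y l yH => @dduc y l j yH))).
move=> h; apply: (is_derive_eq h).
rewrite big_split/= sum_delta /radial1_grad; congr (_ + _).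
rewrite /radial2 !mulr_sumr -sumrB mulr_sumr; apply: eq_bigr => j _.
by ring.
Qed.

Lemma is_derive_kelvin_radial x i : half_space R n x ->
  is_derive x (e_ i) kelvin_radial (kelvin_radial_grad i x).
Proof.
move=> xH; have r0 := half_space_sqdist_gt0 oB xH.
exact: (is_derive_addf
  (is_derive_mulcf (2 * k) (is_derive_comp_inversion i oB s0 xH ud duc))
  (is_derive_mulcf (2 * s) (is_derive_mulf
     (is_derive_invf r0 (is_derive_sqdist o x i)) (is_derive_radial1 i xH)))).
Qed.

Lemma is_derive_kelvin_grad x i : half_space R n x ->
  is_derive x (e_ i) (kelvin_grad i) (kelvin_hess i x).
Proof.
move=> xH; have r0 := half_space_sqdist_gt0 oB xH.
have -> : kelvin_grad i = (fun y => rho y `^ (- k - 1) *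
    (s * du i (phi y) + -1 * (d i y * kelvin_radial y))).
  by apply/funext => y; rewrite /kelvin_grad mulN1r.
have := is_derive_mulf (is_derive_powf (- k - 1) r0 (is_derive_sqdist o x i))
  (is_derive_addf
    (is_derive_mulcf s (is_derive_comp_inversion i oB s0 xH
       (fun y l yH => @dud y l i yH) (fun y l yH => @dduc y l i yH)))
    (is_derive_mulcf (-1) (is_derive_mulf (is_derive_coord o x i i)
       (is_derive_kelvin_radial i xH)))).
by rewrite eqxx mulN1r.
Qed.

(** The exponent is chosen so that the zeroth and first order radial terms,
    which all assemble into [kelvin_radial], cancel: their total coefficient is
    [2 * (k + 1) - n.+1 - a]. *)
Lemma kelvin_equation (a : R) x : 2 * k = n.+1%:R + a - 2 ->
  half_space R n x ->
  \sum_i kelvin_hess i x + a / x 0 ord_max * kelvin_grad ord_max x =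
  rho x `^ (- k - 1) * (s ^+ 2 / rho x) *
  (\sum_i ddu i i (phi x) + a / phi x 0 ord_max * du ord_max (phi x)).
Proof.
move=> k2 xH; have r0 := half_space_sqdist_gt0 oB xH.
have rn0 : rho x != 0 by rewrite gt_eqF.
set P := rho x `^ (- k - 1 - 1).
have PE : rho x `^ (- k - 1) = P * rho x.
  rewrite -[X in _ * X]powRr1 ?ltW// -powRD; first by rewrite subrK.
  by apply/implyP => _.
set E := radial1 x; set H := radial2 x; set G := kelvin_radial x.
have E1 : \sum_i d i x * du i (phi x) = E by [].
have E2 : \sum_i d i x ^+ 2 = rho x by [].
have E3 : \sum_i d i x * (\sum_l d l x * ddu l i (phi x)) = H by [].
(* The Hessian enters with either index contracted first; exchanging the two
   sums identifies the results. *)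
have E4 : \sum_i d i x * (\sum_j d j x * ddu i j (phi x)) = H.
  rewrite /H /radial2; under eq_bigr do rewrite mulr_sumr.
  rewrite exchange_big/=; apply: eq_bigr => j _; rewrite mulr_sumr.
  by apply: eq_bigr => l _; rewrite mulrCA.
have -> : \sum_i kelvin_hess i x =
    \sum_i ((- (4 * (k + 1)) * P * s) * (d i x * du i (phi x))
     + (2 * (k + 1) * P * G + P * (4 * (k + 1) * s / rho x * E
          + 4 * s ^+ 2 / rho x ^+ 2 * H)) * d i x ^+ 2
     + P * s ^+ 2 * ddu i i (phi x)
     + (- 2 * s ^+ 2 * P / rho x) * (d i x * (\sum_l d l x * ddu l i (phi x)))
     + (- 2 * s ^+ 2 * P / rho x) * (d i x * (\sum_j d j x * ddu i j (phi x)))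
     + (- (P * rho x * G))).
  apply: eq_bigr => i _; rewrite /kelvin_hess /kelvin_radial_grad /radial1_grad.
  rewrite -/E -/H -/G -/P PE; field.
  by [].
rewrite !big_split/= -!mulr_sumr E1 E2 E3 E4 sumr_const card_ord -(mulr_natr (- _) n.+1).
rewrite inversion_ord_max// /kelvin_grad oB subr0 PE -/G.
have -> : G = 2 * k * u (phi x) + 2 * s * ((rho x)^-1 * E) by [].
have -> : n.+1%:R = 2 * k - a + 2 :> R by rewrite k2; ring.
by field; rewrite rn0 !gt_eqF.
Qed.

End KelvinTransform.

Section KelvinLimits.
Context {R : realType} {n : nat}.
Implicit Types (x y o p : 'rV[R]_n.+1) (i j : 'I_n.+1) (D : set 'rV[R]_n.+1).

Lemma half_space_closed : half_space R n `<=` closed_half_space R n.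
Proof. by move=> x; exact: ltW. Qed.

Lemma boundary_closed : half_space_boundary R n `<=` closed_half_space R n.
Proof. by move=> x x0; rewrite /closed_half_space/= x0. Qed.

Lemma cvg_coord D x j : y 0 j @[y --> within D (nbhs x)] --> x 0 j.
Proof.
have c : y 0 j @[y --> x] --> x 0 j by exact: coord_continuous.
exact: cvg_trans (cvg_fmap2 (cvg_within _)) c.
Qed.

Lemma cvg_sqdist D o x : sqdist o y @[y --> within D (nbhs x)] --> sqdist o x.
Proof.
rewrite /sqdist; apply: cvg_big => [|j _]; first exact: add_continuous.
have c : y 0 j - o 0 j @[y --> within D (nbhs x)] --> x 0 j - o 0 j.
  by apply: cvgB; [exact: cvg_coord|exact: cvg_cst].
exact: (cvgM c c).
Qed.

Lemma sqdist_continuous o : continuous (sqdist o).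
Proof.
move=> x P /(@cvg_sqdist setT o x); move=> h.
by apply: (@filterS _ (nbhs x) _ _ _ _ h) => y; exact.
Qed.

Lemma cvg_inversion D o s x : 0 < sqdist o x ->
  inversion o s y @[y --> within D (nbhs x)] --> inversion o s x.
Proof.
move=> r0; apply: cvgD; first exact: cvg_cst.
apply: cvgZ.
  apply: cvgM; first exact: cvg_cst.
  by apply: cvgV; [rewrite gt_eqF|exact: cvg_sqdist].
apply: cvgB; last exact: cvg_cst.
exact: cvg_within.
Qed.

Lemma cvg_within_inversion D E o s x : 0 < sqdist o x ->
  (forall y, D y -> E (inversion o s y)) ->
  inversion o s y @[y --> within D (nbhs x)] --> within E (nbhs (inversion o s x)).
Proof.
move=> r0 DE P /= PE; have h := @cvg_inversion D o s x r0 _ PE.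
by apply: (@filterS _ (nbhs x) _ _ _ _ h) => y /= Py Dy; exact: Py (DE _ Dy).
Qed.

Lemma inversion_closed_half_space o s x : half_space_boundary R n o -> 0 <= s ->
  closed_half_space R n x -> closed_half_space R n (inversion o s x).
Proof.
move=> oB s0 xH; rewrite /closed_half_space/= inversion_ord_max//.
by rewrite mulr_ge0// divr_ge0// sqdist_ge0.
Qed.

Lemma cvg_powR {T : Type} (F : set_system T) {FF : Filter F} (f : T -> R) (l k : R) :
  0 < l -> f y @[y --> F] --> l -> f y `^ k @[y --> F] --> l `^ k.
Proof.
move=> l0 fl; have [dp _] := is_derive1_powR k l0.
have pc : {for l, continuous (fun t : R => t `^ k)}.
  exact/differentiable_continuous/derivable1_diffP.
exact: (cvg_comp f (fun t : R => t `^ k) fl pc).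
Qed.

Lemma cvg_powR_ge0 (k t : R) : 0 < k -> 0 <= t ->
  s `^ k @[s --> within [set s : R | 0 <= s] (nbhs t)] --> t `^ k.
Proof.
move=> k0; rewrite le_eqVlt => /predU1P[<-|t0]; last first.
  by apply: cvg_powR => //; exact: cvg_within.
rewrite powR0 ?gt_eqF//; apply/cvgrPdist_lt => e e0.
have d0 : 0 < e `^ k^-1 by rewrite powR_gt0.
exists (e `^ k^-1) => //= s sd /= s0.
rewrite ?sub0r ?normrN ger0_norm ?powR_ge0//.
have -> : e = (e `^ k^-1) `^ k by rewrite -powRrM mulVf ?gt_eqF// powRr1// ltW.
have {}sd : s < e `^ k^-1.
  by move: sd; rewrite /ball_/= ?sub0r ?normrN ger0_norm.
by apply: gt0_ltr_powR; rewrite // nnegrE// ltW.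
Qed.

(** Only a one-sided statement holds at the boundary, since [powR] is constantly
    1 on the negative half line. *)
Lemma cvg_ord_max_powR (k : R) x : 0 < k -> closed_half_space R n x ->
  y 0 ord_max `^ k @[y --> within (closed_half_space R n) (nbhs x)]
    --> x 0 ord_max `^ k.
Proof.
move=> k0 xH P /(cvg_powR_ge0 k0 xH) h.
have h' := @coord_continuous R 1 n.+1 0 ord_max x _ h.
by apply: (@filterS _ (nbhs x) _ _ _ _ h') => y /= hy; exact: hy.
Qed.

Lemma cvg_kelvin (k s : R) o (u : 'rV[R]_n.+1 -> R) x :
  half_space_boundary R n o -> 0 <= s ->
  {within closed_half_space R n, continuous u} ->
  closed_half_space R n x -> 0 < sqdist o x ->
  kelvin k s o u y @[y --> within (closed_half_space R n) (nbhs x)]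
    --> kelvin k s o u x.
Proof.
move=> oB s0 /subspace_continuousP uc xH r0; apply: cvgM.
  exact: (cvg_powR r0 (@cvg_sqdist _ o x)).
apply: (cvg_comp (inversion o s) u _ (uc _ _)).
  by apply: cvg_within_inversion => // y; exact: inversion_closed_half_space.
exact: inversion_closed_half_space.
Qed.

(** Through the inversion, the conormal derivative of the Kelvin transform is
    that of u plus a multiple of [x_n ^ (a + 1)] with a bounded factor, and
    [a > -1]. *)
Lemma cvg_kelvin_conormal (a k s : R) o (u : 'rV[R]_n.+1 -> R)
    (du : 'I_n.+1 -> 'rV[R]_n.+1 -> R) p :
  -1 < a -> half_space_boundary R n o -> 0 < s ->
  {within closed_half_space R n, continuous u} ->
  (forall i, exists g : 'rV[R]_n.+1 -> R,
     {within closed_half_space R n, continuous g} /\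
     forall x, half_space R n x -> g x = du i x) ->
  (forall q, half_space_boundary R n q ->
     (fun y : 'rV[R]_n.+1 => y 0 ord_max `^ a * du ord_max y)
       @ within (half_space R n) (nbhs q) --> (0 : R)) ->
  half_space_boundary R n p -> 0 < sqdist o p ->
  (fun y : 'rV[R]_n.+1 => y 0 ord_max `^ a * kelvin_grad k s o u du ord_max y)
    @ within (half_space R n) (nbhs p) --> (0 : R).
Proof.
move=> a1 oB s0 uc dug ubd pB r0; set F := within _ _.
have pH := boundary_closed pB.
have to_HS : inversion o s y @[y --> F] --> within (half_space R n) (nbhs (inversion o s p)).
  by apply: cvg_within_inversion => // y; exact: inversion_half_space.
have qB : half_space_boundary R n (inversion o s p).
  by rewrite /half_space_boundary/= inversion_ord_max// pB mulr0.
have qH := boundary_closed qB.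
have sub (q : 'rV[R]_n.+1) :
    within (half_space R n) (nbhs q) `=>` within (closed_half_space R n) (nbhs q).
  move=> P h; apply: (@filterS _ (nbhs q) _ _ _ _ h) => y Py yH.
  exact: Py (half_space_closed yH).
have cu : u (inversion o s y) @[y --> F] --> u (inversion o s p).
  apply: (cvg_comp (inversion o s) u to_HS).
  by move/subspace_continuousP: uc => /(_ _ qH) h P /h; exact: sub.
have cdu i : exists l : R, du i (inversion o s y) @[y --> F] --> l.
  have [g [/subspace_continuousP/(_ _ qH) gc gE]] := dug i.
  exists (g (inversion o s p)); apply: (cvg_comp (inversion o s) (du i) to_HS).
  move=> P /gc/sub h; apply: (@filterS _ (nbhs _) _ _ _ _ h) => y Py yH.
  by rewrite /= -gE//; exact: Py.
have crho : sqdist o y @[y --> F] --> sqdist o p by exact: cvg_sqdist.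
have [l cl] : exists l : R, kelvin_radial k s o u du y @[y --> F] --> l.
  have [l /= cl] := choice cdu.
  exists (2 * k * u (inversion o s p) + 2 * s * ((sqdist o p)^-1 *
    \sum_j (p 0 j - o 0 j) * l j)).
  apply: cvgD; first by apply: cvgM; [exact: cvg_cst|exact: cu].
  apply: cvgM; first exact: cvg_cst.
  apply: cvgM; first by apply: cvgV; [rewrite gt_eqF|exact: crho].
  apply: cvg_big => [|j _]; first exact: add_continuous.
  by apply: cvgM => //; apply: cvgB; [exact: cvg_coord|exact: cvg_cst].
have cn : inversion o s y 0 ord_max `^ a * du ord_max (inversion o s y)
    @[y --> F] --> (0 : R).
  exact: (cvg_comp (inversion o s)
    (fun y : 'rV[R]_n.+1 => y 0 ord_max `^ a * du ord_max y) to_HS (ubd _ qB)).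
have cx : (fun y : 'rV[R]_n.+1 => y 0 ord_max `^ (a + 1)) @ F --> (0 : R).
  have a10 : 0 < a + 1 by rewrite -ltrBlDr sub0r.
  have := cvg_ord_max_powR a10 pH; rewrite pB powR0 ?gt_eqF//.
  by move=> h P /h; exact: sub.
have key : sqdist o y `^ (- k - 1) *
    (s * ((sqdist o y / s) `^ a * (inversion o s y 0 ord_max `^ a * du ord_max (inversion o s y)))
     - y 0 ord_max `^ (a + 1) * kelvin_radial k s o u du y) @[y --> F] -->
    sqdist o p `^ (- k - 1) * (s * ((sqdist o p / s) `^ a * 0) - 0 * l).
  apply: cvgM; first exact: cvg_powR.
  apply: cvgB; last exact: cvgM.
  apply: cvgM; first exact: cvg_cst.
  apply: cvgM => //; apply: cvg_powR; first by rewrite divr_gt0.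
  by apply: cvgM => //; exact: cvg_cst.
rewrite mulr0 mulr0 mul0r subr0 mulr0 in key.
apply: cvg_trans key; apply: near_eq_cvg.
rewrite /F; near=> y.
have yH : half_space R n y by near: y; exact: withinT.
have yn0 : 0 < y 0 ord_max := yH.
have ry := half_space_sqdist_gt0 oB yH.
rewrite /kelvin_grad oB subr0 inversion_ord_max//.
have -> : (sqdist o y / s) `^ a * ((s / sqdist o y * y 0 ord_max) `^ a
    * du ord_max (inversion o s y)) = y 0 ord_max `^ a * du ord_max (inversion o s y).
  have h1 : 0 <= sqdist o y / s by rewrite ltW// divr_gt0.
  have h2 : 0 <= s / sqdist o y * y 0 ord_max by rewrite ltW// mulr_gt0// divr_gt0.
  rewrite mulrA -powRM//.
  by congr (_ `^ _ * _); field; rewrite !gt_eqF.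
have -> : y 0 ord_max `^ (a + 1) = y 0 ord_max `^ a * y 0 ord_max.
  rewrite powRD ?powRr1 ?ltW//; apply/implyP => _; exact: lt0r_neq0.
by ring.
Unshelve. all: by end_near. Qed.

End KelvinLimits.

(** * Comparison with the Kelvin transform *)

Section Comparison.
Context {R : realType} {n : nat}.
Implicit Types (x y o p : 'rV[R]_n.+1) (i j : 'I_n.+1).

Notation e_ i := (delta_mx 0 i : 'rV[R]_n.+1).

Lemma sqr_coord_le o x j : (x 0 j - o 0 j) ^+ 2 <= sqdist o x.
Proof.
rewrite /sqdist (bigD1 j)//= lerDl; apply: sumr_ge0 => i _; exact: sqr_ge0.
Qed.

Lemma closed_sqdist_le o (M : R) : closed [set x | sqdist o x <= M].
Proof.
have -> : [set x | sqdist o x <= M] = sqdist o @^-1` [set t | t <= M] by [].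
by apply: preimage_closed; [move=> x _; exact: sqdist_continuous|exact: closed_le].
Qed.

Lemma closed_sqdist_ge o (s : R) : closed [set x | s <= sqdist o x].
Proof.
have -> : [set x | s <= sqdist o x] = sqdist o @^-1` [set t | s <= t] by [].
by apply: preimage_closed; [move=> x _; exact: sqdist_continuous|exact: closed_ge].
Qed.

Lemma compact_sqdist_le o (M : R) : compact [set x | sqdist o x <= M].
Proof.
apply: bounded_closed_compact; last exact: closed_sqdist_le.
exists (`|o| + (1 + `|M|)); split; first exact: num_real.
move=> b /ltW ob x /= xM; apply: le_trans ob.
rewrite -[x in `|x|](subrKC o); apply: le_trans (ler_normD _ _) _.
rewrite lerD2l; apply/rV_norm_le => [|j]; first by rewrite addr_ge0.
rewrite rV_subE leNgt; apply/negP => h.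
have := le_trans (sqr_coord_le o x j) (le_trans xM (ler_norm M)).
rewrite -real_normK ?num_real//.
have := normr_ge0 M; move: h; nra.
Qed.

Lemma open_shell o (s M : R) : open [set x | s < sqdist o x < M].
Proof.
have -> : [set x | s < sqdist o x < M] =
    sqdist o @^-1` ([set t | t > s] `&` [set t | t < M]).
  by apply/seteqP; split=> x /=; [move=> /andP[]|move=> []] => -> ->.
apply: open_comp; first by move=> x _; exact: sqdist_continuous.
by apply: openI; [exact: open_gt|exact: open_lt].
Qed.

Lemma compact_shell o (s M : R) : compact [set x | s <= sqdist o x <= M].
Proof.
apply: (subclosed_compact _ (compact_sqdist_le (o := o) (M := M))).
  have -> : [set x | s <= sqdist o x <= M] =
      [set x | s <= sqdist o x] `&` [set x | sqdist o x <= M].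
    by apply/seteqP; split=> x /=; [move=> /andP[]|move=> []] => -> ->.
  by apply: closedI; [exact: closed_sqdist_ge|exact: closed_sqdist_le].
by move=> x /= /andP[].
Qed.

(** The barrier [x_n ^ (1 - a) + x_n ^ 2]: its first term has conormal
    derivative [1 - a > 0] on the flat boundary and is a solution, and on its
    second term, whose conormal derivative vanishes there, the operator takes
    the value [2 * (1 + a) > 0]. Subtracting a small multiple of it makes both
    inequalities of the minimum principle strict. *)
Definition barrier (a : R) x : R := x 0 ord_max `^ (1 - a) + x 0 ord_max ^+ 2.

Definition barrier_grad (a : R) i x : R :=
  ((1 - a) * x 0 ord_max `^ (1 - a - 1) + 2 * x 0 ord_max) * (ord_max == i)%:R.

Definition barrier_hess (a : R) i x : R :=
  ((1 - a) * ((1 - a - 1) * x 0 ord_max `^ (1 - a - 1 - 1)) + 2)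
    * (ord_max == i)%:R.

Lemma is_derive_ord_max x i :
  is_derive x (e_ i) (fun y => y 0 ord_max) (ord_max == i :> 'I_n.+1)%:R.
Proof.
have := is_derive_coord (0 : 'rV[R]_n.+1) x i ord_max.
rewrite (_ : (fun y => _) = (fun y : 'rV[R]_n.+1 => y 0 ord_max)) //.
by apply/funext => y; rewrite mxE subr0.
Qed.

Lemma is_derive_barrier a x i : half_space R n x ->
  is_derive x (e_ i) (barrier a) (barrier_grad a i x).
Proof.
move=> xH; have dx := is_derive_ord_max x i.
have h := is_derive_addf (is_derive_powf (1 - a) xH dx) (is_derive_mulf dx dx).
by apply: (is_derive_eq h); rewrite /barrier_grad; ring.
Qed.

Lemma is_derive_barrier_grad a x i : half_space R n x ->
  is_derive x (e_ i) (barrier_grad a i) (barrier_hess a i x).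
Proof.
move=> xH; have dx := is_derive_ord_max x i.
have h := is_derive_mulf (is_derive_addf
  (is_derive_mulcf (1 - a) (is_derive_powf (1 - a - 1) xH dx))
  (is_derive_mulcf 2 dx)) (is_derive_cstf (ord_max == i)%:R x (e_ i)).
apply: (is_derive_eq h); rewrite /barrier_hess.
by case: eqP => _; rewrite ?mulr1 ?mulr0 ?addr0 //; ring.
Qed.

Lemma barrier_operator a x : half_space R n x ->
  \sum_i barrier_hess a i x + a / x 0 ord_max * barrier_grad a ord_max x
  = 2 * (1 + a).
Proof.
move=> xH; have x0 : x 0 ord_max != 0 by exact: lt0r_neq0.
have -> : \sum_i barrier_hess a i x = barrier_hess a ord_max x.
  rewrite (bigD1 ord_max)//= big1 ?addr0// => i.
  by rewrite eq_sym => /negbTE io; rewrite /barrier_hess io mulr0.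
rewrite /barrier_hess /barrier_grad eqxx !mulr1.
have -> : x 0 ord_max `^ (1 - a - 1) = x 0 ord_max `^ (1 - a - 1 - 1) * x 0 ord_max.
  rewrite -[X in _ * X]powRr1 ?ltW// -powRD; first by rewrite subrK.
  by apply/implyP => _.
by field.
Qed.

Context (a k s : R) (o : 'rV[R]_n.+1)
  (u : 'rV[R]_n.+1 -> R) (du : 'I_n.+1 -> 'rV[R]_n.+1 -> R)
  (ddu : 'I_n.+1 -> 'I_n.+1 -> 'rV[R]_n.+1 -> R).

Context (a_gt : -1 < a) (a_lt : a < 1) (k0 : 0 < k)
  (kE : 2 * k = n.+1%:R + a - 2)
  (oB : half_space_boundary R n o) (s0 : 0 < s)
  (ud : forall x i, half_space R n x -> is_derive x (e_ i) u (du i x))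
  (duc : forall x i, half_space R n x -> {for x, continuous (du i)})
  (dud : forall x i j, half_space R n x ->
     is_derive x (e_ i) (du j) (ddu i j x))
  (dduc : forall x i j, half_space R n x -> {for x, continuous (ddu i j)})
  (u_eq : forall x, half_space R n x ->
     \sum_i ddu i i x + a / x 0 ord_max * du ord_max x = 0)
  (uc : {within closed_half_space R n, continuous u})
  (dug : forall i, exists g : 'rV[R]_n.+1 -> R,
     {within closed_half_space R n, continuous g} /\
     forall x, half_space R n x -> g x = du i x)
  (u_bd : forall q, half_space_boundary R n q ->
     (fun y : 'rV[R]_n.+1 => y 0 ord_max `^ a * du ord_max y)
       @ within (half_space R n) (nbhs q) --> (0 : R))
  (u_ge0 : forall x, closed_half_space R n x -> 0 <= u x).

Notation c := (s `^ k).
Notation v := (kelvin k s o u).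
Notation dv := (kelvin_grad k s o u du).
Notation ddv := (kelvin_hess k s o u du ddu).

Lemma kelvin_on_sphere x : sqdist o x = s -> c * v x = u x.
Proof.
move=> xs; rewrite /kelvin xs powRN mulrA divff ?mul1r; last first.
  by rewrite gt_eqF// powR_gt0.
by rewrite /inversion xs divff ?gt_eqF// scale1r subrKC.
Qed.

Lemma sqdist_inversion x : 0 < sqdist o x ->
  sqdist o (inversion o s x) = s ^+ 2 / sqdist o x.
Proof.
move=> r0; rewrite [LHS]/sqdist.
rewrite (eq_bigr (fun j => (s / sqdist o x) ^+ 2 * (x 0 j - o 0 j) ^+ 2)).
  rewrite -mulr_sumr -/(sqdist o x); field; by rewrite gt_eqF.
by move=> j _; rewrite inversionE; ring.
Qed.

(** The minimum principle on a shell. On the inner sphere the two functions agree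
    and only the barrier is left; on the outer one [u] is nonnegative, and the
    Kelvin transform is at most [B * M ^ (- k)] because the inversion maps it
    into the ball on which [u] is at most [B]. *)
Lemma kelvin_comparison_shell (eps M B : R) p : 0 < eps -> s < M ->
  (forall x, closed_half_space R n x -> sqdist o x <= s -> u x <= B) ->
  closed_half_space R n p -> s <= sqdist o p <= M ->
  - (c * (B * M `^ (- k))) - eps * ((1 + M) `^ (1 - a) + M) <=
  u p + (- c * v p + - eps * barrier a p).
Proof.
move=> eps0 sM uB pH pA.
have M0 : 0 < M := lt_trans s0 sM.
have c0 : 0 < c by rewrite powR_gt0.
have B0 : 0 <= B.
  apply: le_trans (u_ge0 (boundary_closed oB)) (uB o (boundary_closed oB) _).
  by rewrite /sqdist big1 ?ltW// => j _; rewrite subrr expr0n.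
have bar x : closed_half_space R n x -> sqdist o x <= M ->
    barrier a x <= (1 + M) `^ (1 - a) + M.
  move=> xH xM; have xn := sqr_coord_le o x ord_max.
  rewrite oB subr0 in xn; have {xn}xM2 := le_trans xn xM.
  apply: lerD => //; apply: ge0_ler_powR; rewrite ?nnegrE//.
  - by rewrite subr_ge0 ltW.
  - by rewrite addr_ge0// ltW.
  - rewrite leNgt; apply/negP => h; move: xM2 h M0; nra.
pose w x : R := u x + (- c * v x + - eps * barrier a x).
pose dw i x : R := du i x + (- c * dv i x + - eps * barrier_grad a i x).
pose ddw i x : R := ddu i i x + (- c * ddv i x + - eps * barrier_hess a i x).
apply: (@minimum_principle R n a _ [set x | s <= sqdist o x <= M]
  [set x | s < sqdist o x < M] w dw ddw _ _ _ _ _ _ _ _ _ p pH pA).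
- exact: compact_shell.
- exact: open_shell.
- by move=> x /= /andP[/ltW -> /ltW ->].
- apply/subspace_continuousP => x [/= /andP[sx xM] xH].
  have r0 := lt_le_trans s0 sx.
  suff h : w y @[y --> within (closed_half_space R n) (nbhs x)] --> w x.
    move=> P /h {}h; apply: (@filterS _ (nbhs x) _ _ _ _ h) => y Py [_ yH].
    exact: Py.
  apply: cvgD; first by move/subspace_continuousP: uc; exact.
  apply: cvgD.
    by apply: cvgM; [exact: cvg_cst|exact: (@cvg_kelvin R n k s o u x oB (ltW s0) uc xH r0)].
  apply: cvgM; first exact: cvg_cst.
  apply: cvgD; first by apply: cvg_ord_max_powR => //; rewrite subr_gt0.
  by apply: cvgM; exact: cvg_coord.
- move=> x i xH _.
  exact: (is_derive_addf (ud i xH) (is_derive_addf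
    (is_derive_mulcf (- c) (is_derive_kelvin k oB s0 ud duc i xH))
    (is_derive_mulcf (- eps) (is_derive_barrier a i xH)))).
- move=> x i xH _.
  exact: (is_derive_addf (dud i i xH) (is_derive_addf
    (is_derive_mulcf (- c) (is_derive_kelvin_grad k oB s0 ud duc dud dduc i xH))
    (is_derive_mulcf (- eps) (is_derive_barrier_grad a i xH)))).
- move=> x xH _; have -> : \sum_i ddw i x = \sum_i ddu i i x
      + (- c * \sum_i ddv i x + - eps * \sum_i barrier_hess a i x).
    rewrite /ddw big_split/= [X in _ + X = _]big_split/=.
    by congr (_ + (_ + _)); rewrite mulr_sumr.
  rewrite /dw.
  have Lv := kelvin_equation u du ddu oB s0 kE xH.
  rewrite u_eq ?mulr0 in Lv; last exact: inversion_half_space.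
  have Lu := u_eq xH; have Lb := barrier_operator a xH.
  set S1 := \sum_i ddu i i x in Lu *.
  set S2 := \sum_i ddv i x in Lv *.
  set S3 := \sum_i barrier_hess a i x in Lb *.
  set q := a / x 0 ord_max in Lu Lv Lb *.
  have -> : S1 + (- c * S2 + - eps * S3) + q * (du ord_max x +
      (- c * dv ord_max x + - eps * barrier_grad a ord_max x)) =
      (S1 + q * du ord_max x) + - c * (S2 + q * dv ord_max x)
      + - eps * (S3 + q * barrier_grad a ord_max x) by ring.
  rewrite Lu Lv Lb mulr0 !add0r mulNr oppr_lt0 !mulr_gt0//.
  by rewrite -ltrBlDl sub0r.
- move=> q qB /= /andP[sq qM].
  have r0 := lt_trans s0 sq.
  have cdw : (fun y : 'rV[R]_n.+1 => y 0 ord_max `^ a * du ord_max y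
      + (- c * (y 0 ord_max `^ a * dv ord_max y)
      + - eps * ((1 - a) + 2 * y 0 ord_max `^ (a + 1))))
      @ within (half_space R n) (nbhs q) -->
      0 + (- c * 0 + - eps * ((1 - a) + 2 * 0)).
    apply: cvgD; first exact: u_bd.
    apply: cvgD; apply: cvgM; try exact: cvg_cst.
      exact: cvg_kelvin_conormal.
    apply: cvgD; first exact: cvg_cst.
    apply: cvgM; first exact: cvg_cst.
    have a10 : 0 < a + 1 by rewrite -ltrBlDr sub0r.
    have := cvg_ord_max_powR a10 (boundary_closed qB).
    rewrite qB powR0 ?gt_eqF// => h P /h {}h.
    apply: (@filterS _ (nbhs q) _ _ _ _ h) => y Py yH.
    exact: Py (half_space_closed yH).
  have lneg : 0 + (- c * 0 + - eps * ((1 - a) + 2 * 0)) < 0.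
    by rewrite !mulr0 addr0 !add0r mulNr oppr_lt0 mulr_gt0// subr_gt0.
  have := cvgr_lt _ cdw _ lneg; move=> /(_ (within_filter _ _)).
  rewrite !near_withinE => h; apply: filterS h => y hy yH.
  have yn0 : 0 < y 0 ord_max := yH.
  have ya : 0 < y 0 ord_max `^ a by rewrite powR_gt0.
  rewrite -(pmulr_rlt0 _ ya); apply: le_lt_trans (hy yH).
  rewrite /dw /barrier_grad eqxx mulr1.
  have -> : 1 - a - 1 = - a by ring.
  have -> : y 0 ord_max `^ (a + 1) = y 0 ord_max `^ a * y 0 ord_max.
    rewrite powRD ?powRr1 ?ltW//; apply/implyP => _; exact: lt0r_neq0.
  rewrite powRN le_eqVlt; apply/orP; left; apply/eqP; field.
  by rewrite gt_eqF.
- move=> x xH /= /andP[sx xM] xU; have r0 := lt_le_trans s0 sx.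
  rewrite /w; have := bar x xH xM; rewrite -(ler_pM2l eps0) => bx.
  have cBM : 0 <= c * (B * M `^ (- k)).
    by rewrite !mulr_ge0 ?powR_ge0.
  move: sx; rewrite le_eqVlt => /predU1P[xs|sx].
    by have := kelvin_on_sphere (esym xs); lra.
  have {xU}xM' : sqdist o x = M.
    apply/eqP; rewrite eq_le xM leNgt; apply/negP => xM'.
    by apply: xU; rewrite /= sx.
  have iH := inversion_closed_half_space oB (ltW s0) xH.
  have vx : c * v x <= c * (B * M `^ (- k)).
    rewrite ler_pM2l// /kelvin xM' mulrC ler_wpM2r ?powR_ge0// uB//.
    rewrite sqdist_inversion// ler_pdivrMr// expr2 ler_pM2l// ltW//.
  by have := u_ge0 xH; lra.
Qed.

(** The outer radius is sent to infinity, where [k > 0] makes the Kelvin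
    transform vanish, and for each radius the barrier is made small enough. *)
Lemma kelvin_comparison p : closed_half_space R n p -> s <= sqdist o p ->
  c * v p <= u p.
Proof.
move=> pH sp; have c0 : 0 < c by rewrite powR_gt0.
have oH := boundary_closed oB.
pose K := [set x | sqdist o x <= s] `&` closed_half_space R n.
have oo : sqdist o o = 0 by rewrite /sqdist big1// => j _; rewrite subrr expr0n.
have [B B0 uB] : exists2 B, 0 <= B &
    forall x, closed_half_space R n x -> sqdist o x <= s -> u x <= B.
  have Kc : compact K.
    apply: (subclosed_compact _ (@compact_sqdist_le o s)); last by move=> x [].
    by apply: closedI; [exact: closed_sqdist_le|exact: closed_closed_half_space].
  have K0 : K !=set0 by exists o; split=> //=; rewrite oo ltW.
  have Ku : {within K, continuous u}.
    by apply: continuous_subspaceW uc => x [].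
  have [b /set_mem[_ bH] bmax] := EVT_max_rV K0 Kc Ku.
  by exists (u b); [exact: u_ge0|move=> x xH xs; apply/bmax/mem_set].
apply/ler_addgt0Pr => e e0.
pose q := c * B / (e / 2).
have e20 : 0 < e / 2 by rewrite divr_gt0.
have q0 : 0 <= q by rewrite divr_ge0 ?(ltW e20)// mulr_ge0 ?(ltW c0).
(* The last summand is the radius at which the decay of the Kelvin transform
   has brought its bound down to e / 2. *)
pose M := sqdist o p + 1 + q `^ k^-1.
have qk := powR_ge0 q k^-1.
have pM : sqdist o p <= M by rewrite /M; lra.
have sM : s < M by rewrite /M; lra.
have M0 : 0 < M := lt_trans s0 sM.
have Mk0 : 0 < M `^ k by rewrite powR_gt0.
have tail : c * (B * M `^ (- k)) <= e / 2.
  have qM : q <= M `^ k.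
    rewrite -[leLHS]powRr1// -(@mulVf _ k) ?gt_eqF// powRrM.
    apply: ge0_ler_powR; rewrite ?nnegrE ?(ltW k0) ?(ltW M0)//.
    by rewrite /M; have := sqdist_ge0 o p; lra.
  by rewrite mulrA powRN ler_pdivrMr// [leRHS]mulrC -ler_pdivrMr.
pose C := (1 + M) `^ (1 - a) + M.
have C0 : 0 < C by rewrite ltr_wpDl// powR_ge0.
have eps0 : 0 < e / 2 / C by rewrite divr_gt0.
have := kelvin_comparison_shell eps0 sM uB pH; rewrite sp pM => /(_ isT).
rewrite -/C divfK ?gt_eqF//.
have bar0 : 0 <= e / 2 / C * barrier a p.
  by rewrite mulr_ge0 ?(ltW eps0)// addr_ge0 ?powR_ge0 ?sqr_ge0.
lra.
Qed.

End Comparison.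

(** * Entire positive solutions are constant *)

Section Liouville.
Context {R : realType} {n : nat}.
Implicit Types (x y z o p : 'rV[R]_n.+1) (i j : 'I_n.+1).

Notation e_ i := (delta_mx 0 i : 'rV[R]_n.+1).

Lemma closed_half_space_ind (u : 'rV[R]_n.+1 -> R) (P : set R) :
  {within closed_half_space R n, continuous u} -> closed P ->
  (forall x, half_space R n x -> P (u x)) ->
  forall x, closed_half_space R n x -> P (u x).
Proof.
move=> /subspace_continuousP uc cP uP x xH; apply: contrapT => nP.
have nearP : nbhs (u x) (~` P).
  by apply: open_nbhs_nbhs; split=> //; exact: closed_openC.
have [r r0 rP] := nbhs_line ord_max (uc x xH _ nearP).
have r20 : 0 < r / 2 by rewrite divr_gt0.
have yH : half_space R n (x + (r / 2) *: e_ ord_max).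
  by rewrite /half_space/= rV_line_coord eqxx mulr1 ltr_wpDl.
have r2 : `|r / 2| < r by rewrite gtr0_norm// ltr_pdivrMr// ltr_pMr// ltr1n.
exact: (rP _ r2 (half_space_closed yH)) (uP _ yH).
Qed.

Context (a k : R)
  (u : 'rV[R]_n.+1 -> R) (du : 'I_n.+1 -> 'rV[R]_n.+1 -> R)
  (ddu : 'I_n.+1 -> 'I_n.+1 -> 'rV[R]_n.+1 -> R).

Context (a_gt : -1 < a) (a_lt : a < 1) (k0 : 0 < k)
  (kE : 2 * k = n.+1%:R + a - 2)
  (ud : forall x i, half_space R n x -> is_derive x (e_ i) u (du i x))
  (duc : forall x i, half_space R n x -> {for x, continuous (du i)})
  (dud : forall x i j, half_space R n x ->
     is_derive x (e_ i) (du j) (ddu i j x))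
  (dduc : forall x i j, half_space R n x -> {for x, continuous (ddu i j)})
  (u_eq : forall x, half_space R n x ->
     \sum_i ddu i i x + a / x 0 ord_max * du ord_max x = 0)
  (uc : {within closed_half_space R n, continuous u})
  (dug : forall i, exists g : 'rV[R]_n.+1 -> R,
     {within closed_half_space R n, continuous g} /\
     forall x, half_space R n x -> g x = du i x)
  (u_bd : forall q, half_space_boundary R n q ->
     (fun y : 'rV[R]_n.+1 => y 0 ord_max `^ a * du ord_max y)
       @ within (half_space R n) (nbhs q) --> (0 : R))
  (u_ge0 : forall x, closed_half_space R n x -> 0 <= u x).

(** The points [y] and [z] are exchanged by the inversion centred where the
    line through them meets the flat boundary. *)
Lemma comparison_of_heights y z : half_space R n y -> half_space R n z ->
  z 0 ord_max < y 0 ord_max ->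
  (z 0 ord_max / y 0 ord_max) `^ k * u z <= u y.
Proof.
move=> yH zH zy; have y0 : 0 < y 0 ord_max := yH.
have z0 : 0 < z 0 ord_max := zH.
set t := z 0 ord_max / y 0 ord_max.
have t0 : 0 < t by rewrite divr_gt0.
have t1 : t < 1 by rewrite ltr_pdivrMr// mul1r.
have t10 : 1 - t != 0 by rewrite subr_eq0 gt_eqF.
(* The point of that line with last coordinate 0, so that z - o = t *: (y - o). *)
pose o := (1 - t)^-1 *: (z - t *: y).
have oB : half_space_boundary R n o.
  rewrite /half_space_boundary/= !mxE /t divfK ?gt_eqF//.
  by rewrite subrr mulr0.
have r0 := half_space_sqdist_gt0 oB yH.
have s0 : 0 < t * sqdist o y by rewrite mulr_gt0.
have sr : t * sqdist o y <= sqdist o y by rewrite ler_piMl// ltW.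
have zE : inversion o (t * sqdist o y) y = z.
  apply/rowP => j; rewrite inversionE mulfK ?gt_eqF// !mxE.
  by field.
have := kelvin_comparison a_gt a_lt k0 kE oB s0 ud duc dud dduc u_eq uc dug u_bd
  u_ge0 (half_space_closed yH) sr.
rewrite /kelvin zE mulrA powRM ?(ltW t0) ?(ltW r0)// -[X in X * u z]mulrA -powRD.
  by rewrite subrr powRr0 mulr1.
by apply/implyP => _; rewrite gt_eqF.
Qed.

(** The point [z] is approached from below along the normal, where the
    comparison applies and its factor tends to 1. *)
Lemma comparison_at_equal_heights y z : half_space R n y -> half_space R n z ->
  z 0 ord_max = y 0 ord_max -> u z <= u y.
Proof.
move=> yH zH zy; have z0 : 0 < z 0 ord_max := zH.
pose f (t : R) : R :=
  ((z 0 ord_max + t) / z 0 ord_max) `^ k * u (z + t *: e_ ord_max).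
have uz : {for (0 : R), continuous (fun t : R => u (z + t *: e_ ord_max))}.
  apply/differentiable_continuous/derivable1_diffP.
  by have [] := (is_derive_line0 _ _ _ _).1 (ud ord_max zH).
have f0 : f t @[t --> (0 : R)^'-] --> u z.
  have -> : u z = ((z 0 ord_max + 0) / z 0 ord_max) `^ k * u (z + (0 : R) *: e_ ord_max).
    by rewrite addr0 divff ?gt_eqF// powR1 mul1r scale0r addr0.
  apply: cvgM; last exact: cvg_at_left_filter.
  apply: cvg_powR; first by rewrite addr0 divff ?gt_eqF.
  apply: cvgM; last exact: cvg_cst.
  apply: cvgD; first exact: cvg_cst.
  exact/cvg_at_left_filter/cvg_id.
apply: (cvgr_to_le f0); near=> t.
have t0 : t < 0 by near: t; exact: nbhs_left_lt.
have tz : - z 0 ord_max < t by near: t; apply: nbhs_left_gt; rewrite oppr_lt0.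
have ztE : (z + t *: e_ ord_max) 0 ord_max = z 0 ord_max + t.
  by rewrite rV_line_coord eqxx mulr1.
have ztH : half_space R n (z + t *: e_ ord_max).
  by rewrite /half_space/= ztE -ltrBlDl sub0r.
have := comparison_of_heights yH ztH; rewrite ztE -zy => h.
by apply: h; rewrite gtrDl.
Unshelve. all: by end_near. Qed.

Lemma equal_heights y z : half_space R n y -> half_space R n z ->
  z 0 ord_max = y 0 ord_max -> u z = u y.
Proof.
by move=> yH zH zy; apply/eqP; rewrite eq_le !comparison_at_equal_heights.
Qed.

Lemma tangential_half_space x i (t : R) : i != ord_max ->
  half_space R n x -> half_space R n (x + t *: e_ i).
Proof.
by move=> io xH; rewrite /half_space/= rV_line_coord eq_sym (negbTE io) mulr0 addr0.
Qed.

Lemma is_derive_tangential_cst (f : 'rV[R]_n.+1 -> R) x i (l : R) :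
  (forall t : R, f (x + t *: e_ i) = f x) -> is_derive x (e_ i) f l -> l = 0.
Proof.
move=> fx /is_derive_line0 [_ <-].
rewrite (_ : (fun s : R => f (x + s *: e_ i)) = fun=> f x) ?derive_cst//.
by apply/funext => t; rewrite fx.
Qed.

Lemma tangential_derivative x i : i != ord_max -> half_space R n x -> du i x = 0.
Proof.
move=> io xH; apply: is_derive_tangential_cst (ud i xH) => t.
apply: equal_heights => //; first exact: tangential_half_space.
by rewrite rV_line_coord eq_sym (negbTE io) mulr0 addr0.
Qed.

(** A horizontal line stays at constant height, so [u] and its tangential
    derivatives are constant along it and only normal derivatives survive. *)
Lemma normal_equation x : half_space R n x ->
  ddu ord_max ord_max x + a / x 0 ord_max * du ord_max x = 0.
Proof.
move=> xH; rewrite -(u_eq xH) (bigD1 ord_max)//= big1 ?addr0// => i io.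
apply: is_derive_tangential_cst (dud i i xH) => t.
by rewrite !tangential_derivative//; exact: tangential_half_space.
Qed.

(** On a vertical line the equation says that [t ^ a * du/dt] is constant, and
    the boundary condition says that this constant is zero. *)
Lemma normal_derivative x : half_space R n x -> du ord_max x = 0.
Proof.
move=> xH; have x0 : 0 < x 0 ord_max := xH.
pose o := x + (- x 0 ord_max) *: e_ ord_max.
have oB : half_space_boundary R n o.
  by rewrite /half_space_boundary/= rV_line_coord eqxx mulr1 subrr.
pose p (t : R) := o + t *: e_ ord_max.
have pE t : p t 0 ord_max = t by rewrite rV_line_coord oB eqxx mulr1 add0r.
have pH t : 0 < t -> half_space R n (p t) by rewrite /half_space/= pE.
have px : p (x 0 ord_max) = x by rewrite /p /o -addrA -scalerDl addNr scale0r addr0.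
pose F (t : R) : R := t `^ a * du ord_max (p t).
have Fd (t : R) : 0 < t -> is_derive t 1 F 0.
  move=> t0; have ptH := pH t t0.
  have dl := (is_derive_line _ _ _ _ _).1 (dud ord_max ord_max ptH).
  have h := is_derive_mulf (is_derive1_powR a t0) dl.
  apply: (is_derive_eq h).
  have -> : ddu ord_max ord_max (p t) = - (a / t * du ord_max (p t)).
    by apply/eqP; rewrite -addr_eq0; have := normal_equation ptH; rewrite pE => ->.
  have -> : t `^ a = t `^ (a - 1) * t.
    rewrite -[X in _ * X]powRr1 ?ltW// -powRD; first by rewrite subrK.
    by apply/implyP => _; rewrite gt_eqF.
  by rewrite -/(p t); field; rewrite gt_eqF.
have Fc (s t : R) : 0 < s -> s < t -> F t = F s.
  move=> s0 st; have [|q _ E] := @mean_value_closed R F (fun=> 0) s t st.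
    by move=> q /andP[sq _]; apply: Fd; exact: lt_le_trans sq.
  by apply/eqP; rewrite -subr_eq0 E mul0r.
have F0 : F (x 0 ord_max) = 0.
  apply/eqP; rewrite -normr_eq0 eq_le normr_ge0 andbT.
  apply/ler_addgt0Pr => e e0; rewrite add0r.
  have := u_bd oB => /cvgrPdist_lt /(_ e e0); rewrite near_withinE => near_o.
  have [r r0 rP] := nbhs_line ord_max near_o.
  have m0 : 0 < Num.min r (x 0 ord_max) by rewrite lt_min r0.
  pose t := Num.min r (x 0 ord_max) / 2.
  have t0 : 0 < t by rewrite divr_gt0.
  have : t < Num.min r (x 0 ord_max) by rewrite ltr_pdivrMr// ltr_pMr// ltr1n.
  rewrite lt_min => /andP[tr tx].
  have := rP t; rewrite gtr0_norm// => /(_ tr (pH t t0)).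
  by rewrite -/(p t) pE sub0r normrN (Fc _ _ t0 tx) => /ltW.
move/eqP: F0; rewrite /F px mulf_eq0 gt_eqF ?powR_gt0//=.
by move=> /eqP.
Qed.

Lemma solution_constant x y : half_space R n x -> half_space R n y -> u x = u y.
Proof.
wlog xy : x y / x 0 ord_max <= y 0 ord_max.
  move=> h xH yH; have [/h->//|/ltW/h->//] := leP (x 0 ord_max) (y 0 ord_max).
move=> xH yH; have x0 : 0 < x 0 ord_max := xH.
pose z := x + (y 0 ord_max - x 0 ord_max) *: e_ ord_max.
have zE : z 0 ord_max = y 0 ord_max.
  by rewrite rV_line_coord eqxx mulr1 addrC subrK.
have zH : half_space R n z by rewrite /half_space/= zE.
rewrite -(equal_heights yH zH zE).
move: xy; rewrite le_eqVlt => /predU1P[xy|xy].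
  by rewrite /z xy subrr scale0r addr0.
have xy0 : 0 < y 0 ord_max - x 0 ord_max by rewrite subr_gt0.
have [|c _ E] := @mean_value_closed R (fun t : R => u (x + t *: e_ ord_max))
    (fun=> 0) 0 (y 0 ord_max - x 0 ord_max) xy0.
  move=> t /andP[t0 _].
  have tH : half_space R n (x + t *: e_ ord_max).
    by rewrite /half_space/= rV_line_coord eqxx mulr1 ltr_wpDr.
  have := (is_derive_line _ _ _ _ _).1 (ud ord_max tH).
  by rewrite normal_derivative.
by move/eqP: E; rewrite mul0r subr_eq0 scale0r addr0 eq_sym => /eqP.
Qed.

End Liouville.

Theorem theorem1p2 (R : realType) (n : nat) (a : R) (u : 'rV[R]_n.+1 -> R)
  (hn : (2 <= n.+1)%N)
  (ha_gt : Num.max (-1) (2 - n.+1%:R) < a)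
  (ha_lt : a < 1)
  (u_C2 : Ck 2 (half_space R n) u)
  (u_C1 : C1_closure (half_space R n) u)
  (u_eq : forall x, half_space R n x ->
     div (fun y : 'rV[R]_n.+1 => y 0 ord_max `^ a *: grad u y) x = 0)
  (u_gt0 : forall x, half_space R n x -> 0 < u x)
  (u_bd : forall x0, half_space_boundary R n x0 ->
     (fun y : 'rV[R]_n.+1 => y 0 ord_max `^ a * partial ord_max u y)
       @ within (half_space R n) (nbhs x0) --> (0 : R)) :
  exists2 C : R, 0 < C & forall x, closed_half_space R n x -> u x = C.
Proof.
move: ha_gt; rewrite gt_max => /andP[a_gt a_gtn].
pose k := (n.+1%:R + a - 2) / 2.
have k0 : 0 < k by rewrite divr_gt0//; lra.
have kE : 2 * k = n.+1%:R + a - 2 by rewrite /k mulrC divfK.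
have [_ C2] := u_C2.
pose du (i : 'I_n.+1) := partial i u.
pose ddu (i j : 'I_n.+1) := partial i (partial j u).
have ud (x : 'rV[R]_n.+1) i : half_space R n x -> is_derive x (delta_mx 0 i) u (du i x).
  by move=> xH; apply: derivableP; exact: (C2 i).1.
have duc (x : 'rV[R]_n.+1) i : half_space R n x -> {for x, continuous (du i)}.
  by move=> xH; have [_ [h _]] := C2 i; exact: h.
have dud (x : 'rV[R]_n.+1) i j : half_space R n x ->
    is_derive x (delta_mx 0 i) (du j) (ddu i j x).
  by move=> xH; apply: derivableP; have [_ [_ h]] := C2 j; exact: (h i).1.
have dduc (x : 'rV[R]_n.+1) i j : half_space R n x -> {for x, continuous (ddu i j)}.
  by move=> xH; have [_ [_ h]] := C2 j; have [_ [h' _]] := h i; exact: h'.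
have nondiv (x : 'rV[R]_n.+1) : half_space R n x ->
    \sum_i ddu i i x + a / x 0 ord_max * du ord_max x = 0.
  move=> xH; have x0 : 0 < x 0 ord_max := xH.
  have xa : x 0 ord_max `^ a != 0 by rewrite gt_eqF// powR_gt0.
  apply: (mulfI xa); rewrite mulr0 -[RHS](u_eq x xH) /div mulrDr mulr_sumr.
  (* For i = n the weight x_n ^ a is differentiated too, which gives the first
     order term. *)
  have summand i : partial i (fun y : 'rV[R]_n.+1 => (y 0 ord_max `^ a *: grad u y) 0 i) x
      = (i == ord_max)%:R * (a * x 0 ord_max `^ (a - 1) * du i x)
        + x 0 ord_max `^ a * ddu i i x.
    rewrite /partial.
    have -> : (fun y : 'rV[R]_n.+1 => (y 0 ord_max `^ a *: grad u y) 0 i)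
        = (fun y => y 0 ord_max `^ a * du i y) by apply/funext => y; rewrite !mxE.
    have [_ ->] := is_derive_mulf (is_derive_powf a x0 (is_derive_ord_max x i))
      (dud x i i xH).
    by rewrite eq_sym; ring.
  rewrite (eq_bigr _ (fun i _ => summand i)) big_split/= sum_delta addrC.
  congr (_ + _).
  have -> : x 0 ord_max `^ a = x 0 ord_max `^ (a - 1) * x 0 ord_max.
    rewrite -[X in _ * X]powRr1 ?ltW// -powRD; first by rewrite subrK.
    by apply/implyP => _; rewrite gt_eqF.
  by field; rewrite gt_eqF.
have [_ uc dug] := u_C1; rewrite closure_half_space in uc dug.
have u_ge0 := closed_half_space_ind uc (@closed_ge R 0) (fun x xH => ltW (u_gt0 x xH)).
pose x1 : 'rV[R]_n.+1 := const_mx 1.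
have x1H : half_space R n x1 by rewrite /half_space/= mxE ltr01.
exists (u x1); first exact: u_gt0.
apply: (closed_half_space_ind uc (P := [set t | t = u x1])).
  exact: closed_eq.
move=> x xH /=.
exact: (solution_constant a_gt ha_lt k0 kE ud duc dud dduc nondiv uc dug u_bd u_ge0).
Qed.
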